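(* Let $G$ be a finite group and let $S$ be a Sylow $p$-subgroup of $G$, where $p$ is the smallest prime divisor of $|G|$. Suppose that $\exp(S)=p$ and that every minimal subgroup of $S$ is weakly $S\Phi$-supplemented in $G$. Then the fusion system $\mathcal{F}_S(G)$ is supersolvable.
   Context: All groups are finite. A minimal subgroup is a subgroup of prime order; $\exp(S)$ is the exponent of $S$. A subgroup $A$ of $G$ is $S$-permutable in $G$ if $AQ=QA$ for all Sylow subgroups $Q$ of $G$ (for all primes; the letter $S$ in the terms ''$S$-permutable'' and ''$S\Phi$-supplemented'' does not refer to the Sylow subgroup $S$). For a subgroup $H\le G$, $H_{sG}$ denotes the subgroup of $H$ generated by all subgroups of $H$ which are $S$-permutable in $G$. $\Phi(H)$ denotes the Frattini subgroup of $H$. A subgroup $H$ of $G$ is weakly $S\Phi$-supplemented in $G$ if there exists a subgroup $T$ of $G$ such that $G=HT$ and $H\cap T\le \Phi(H)H_{sG}$. $\mathcal{F}_S(G)$ is the (saturated) fusion system over $S$ whose objects are all subgroups of $S$ and whose morphisms $P\to Q$ are the maps $x\mapsto x^g$ with $g\in G$ and $P^g\le Q$. For a fusion system $\mathcal{F}$ over a $p$-group $S$, a subgroup $A\le S$ is strongly $\mathcal{F}$-closed if for every $P\le A$ and every morphism $\phi\in \mathrm{Hom}_{\mathcal{F}}(P,S)$ one has $\phi(P)\le A$. A saturated fusion system $\mathcal{F}$ over a $p$-group $S$ is supersolvable if there is a series of subgroups $1=S_0\le S_1\le\cdots\le S_n=S$ such that each $S_i$ $(0\le i\le n)$ is strongly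 $\mathcal{F}$-closed and $S_{i+1}/S_i$ is cyclic for all $0\le i\le n-1$. *)

(* Defs.v *)
From mathcomp Require Import all_boot all_fingroup all_solvable.

Set Implicit Arguments.
Unset Strict Implicit.
Unset Printing Implicit Defensive.

Import GroupScope.

Section SPhiSupplements.

Variable gT : finGroupType.
Implicit Types A G H Q T : {group gT}.

Definition s_permutable G A :=
  (A \subset G) && [forall Q : {group gT}, Sylow G Q ==> (A * Q == Q * A)].

(* H_{sG} *)
Definition s_core G H : {set gT} :=
  <<\bigcup_(A : {group gT} | (A \subset H) && s_permutable G A) A>>.

Definition weakly_SPhi_supplemented G H :=
  exists T : {group gT},
    [/\ T \subset G, G = H * T :> {set gT}
      & H :&: T \subset 'Phi(H) * s_core G H].

End SPhiSupplements.

(* A morphism P -> Q is represented by a function gT -> gT of which only the  *)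
(* restriction to P is meaningful, whence fhom_ext. The identities (and all   *)
(* inclusions) are the instance s = 1 of fhom_conj.                           *)
Record fusion_system (p : nat) (gT : finGroupType) (S : {group gT}) := Fusion {
  fhom : {group gT} -> {group gT} -> (gT -> gT) -> Prop;
  fhom_pgroup : p.-group S;
  fhom_obj : forall P Q phi, fhom P Q phi -> P \subset S /\ Q \subset S;
  fhom_ext : forall (P Q : {group gT}) (phi psi : gT -> gT),
    {in P, phi =1 psi} -> fhom P Q phi -> fhom P Q psi;
  fhom_mono : forall (P Q : {group gT}) (phi : gT -> gT), fhom P Q phi ->
    [/\ {in P &, {morph phi : x y / x * y}}, {in P &, injective phi}
      & phi @: P \subset Q];
  fhom_comp : forall P Q R phi psi,
    fhom P Q phi -> fhom Q R psi -> fhom P R (psi \o phi);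
  fhom_conj : forall (P Q : {group gT}) s, P \subset S -> Q \subset S ->
    s \in S -> P :^ s \subset Q -> fhom P Q (conjg^~ s);
  (* every morphism is an isomorphism onto its image, then an inclusion *)
  fhom_iso : forall (P Q R : {group gT}) (phi psi : gT -> gT), fhom P Q phi ->
    phi @: P = R -> {in P, cancel phi psi} -> fhom P R phi /\ fhom R P psi
}.

Section FusionOfGroup.

Variables (p : nat) (gT : finGroupType) (G S : {group gT}).
Implicit Types (P Q R : {group gT}) (phi psi : gT -> gT).
Hypothesis sylS : p.-Sylow(G) S.

Definition conj_hom P Q phi : Prop :=
  [/\ P \subset S, Q \subset S
    & exists g, [/\ g \in G, P :^ g \subset Q & {in P, phi =1 conjg^~ g}]].

Fact conj_hom_pgroup : p.-group S.
Proof. exact: pHall_pgroup sylS. Qed.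

Fact conj_hom_obj P Q phi : conj_hom P Q phi -> P \subset S /\ Q \subset S.
Proof. by case. Qed.

Fact conj_hom_ext P Q phi psi :
  {in P, phi =1 psi} -> conj_hom P Q phi -> conj_hom P Q psi.
Proof.
move=> eq_phi [sPS sQS [g [Gg sPgQ def_phi]]]; split=> //; exists g.
by split=> // x Px; rewrite -eq_phi ?def_phi.
Qed.

Fact conj_hom_mono P Q phi : conj_hom P Q phi ->
  [/\ {in P &, {morph phi : x y / x * y}}, {in P &, injective phi}
    & phi @: P \subset Q].
Proof.
case=> _ _ [g [_ sPgQ def_phi]]; split.
- by move=> x y Px Py; rewrite !def_phi ?groupM ?conjMg.
- by move=> x y Px Py; rewrite !def_phi // => /conjg_inj.
- by rewrite (eq_in_imset def_phi).
Qed.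

Fact conj_hom_comp P Q R phi psi :
  conj_hom P Q phi -> conj_hom Q R psi -> conj_hom P R (psi \o phi).
Proof.
case=> sPS _ [g [Gg sPgQ def_phi]] [_ sRS [h [Gh sQhR def_psi]]].
split=> //; exists (g * h); split; first exact: groupM.
  by rewrite conjsgM (subset_trans _ sQhR) ?conjSg.
move=> x Px /=; rewrite def_phi // def_psi ?conjgM //.
by rewrite (subsetP sPgQ) ?memJ_conjg.
Qed.

Fact conj_hom_conj P Q s : P \subset S -> Q \subset S ->
  s \in S -> P :^ s \subset Q -> conj_hom P Q (conjg^~ s).
Proof.
move=> sPS sQS Ss sPsQ; split=> //; exists s.
by split=> //; apply: (subsetP (pHall_sub sylS)).
Qed.

Fact conj_hom_iso P Q R phi psi : conj_hom P Q phi ->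
  phi @: P = R -> {in P, cancel phi psi} -> conj_hom P R phi /\ conj_hom R P psi.
Proof.
case=> sPS sQS [g [Gg sPgQ def_phi]] defR phiK.
have defPg: P :^ g = R by rewrite -defR (eq_in_imset def_phi).
have sRS: R \subset S by rewrite -defPg (subset_trans sPgQ).
split; split=> //; first by exists g; rewrite defPg.
exists g^-1; split; first by rewrite groupV.
  by rewrite -defPg conjsgK.
move=> y; rewrite -defR => /imsetP[x Px ->].
by rewrite phiK // def_phi // conjgK.
Qed.

(* F_S(G) *)
Definition fusion_of_group : fusion_system p S :=
  Fusion conj_hom_pgroup conj_hom_obj conj_hom_ext conj_hom_mono
    conj_hom_comp conj_hom_conj conj_hom_iso.

End FusionOfGroup.

Section Supersolvable.

Variables (p : nat) (gT : finGroupType) (S : {group gT}).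
Implicit Types (F : fusion_system p S) (A P : {group gT}).

Definition strongly_closed F A :=
  A \subset S /\
  forall P phi, P \subset A -> fhom F P S phi -> phi @: P \subset A.

(* The term is usually reserved for saturated F, which F_S(G) always is when  *)
(* S is Sylow in G. Strongly closed subgroups are normal in S, by fhom_conj,  *)
(* so the quotients U i.+1 / U i are genuine.                                 *)
Definition supersolvable F :=
  exists (n : nat) (U : nat -> {group gT}),
    [/\ U 0%N = 1 :> {set gT}, U n = S,
        forall i, i < n -> U i \subset U i.+1,
        forall i, i <= n -> strongly_closed F (U i)
      & forall i, i < n -> cyclic (U i.+1 / U i)].

End Supersolvable.

(* Main.v *)
Require Import Defs.
From mathcomp Require Import all_boot all_fingroup all_solvable.

(** The group G turns out to be p-nilpotent, and then S alone controls fusion.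

    Let H be a subgroup of S of order p. Its Frattini subgroup is trivial and
    its S-permutable core is 1 or H, so a supplement T as in the hypothesis
    either meets H trivially or forces H to be S-permutable
    ([weakly_SPhi_prime]). In the first case T has index p, the least prime
    divisor of the order of G, hence is normal ([normal_index_min_prime]), and
    then T contains K = O^p(G). In the second case H is centralised by all
    Sylow q-subgroups with q <> p ([s_permutable_cent_Sylow]), and these
    generate K. If H lies in K the first case is impossible, because H and T
    meet trivially. Since S has exponent p, every nontrivial element of
    P = K :&: S generates such an H, so P is central in K.

    Being a central Sylow subgroup of K, P has a complement D in K by
    Schur-Zassenhaus, and D is characteristic in K as its largest normal
    p'-subgroup. So D is normal in G, G = D S and D meets S trivially. In this
    situation conjugation by an element of G, where it maps a subgroup of S into
    S, agrees with conjugation by an element of S; so all normal subgroups of S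
    are strongly closed ([strongly_closed_normal_compl]). The required series is
    a chief series of the p-group S ([pgroup_normal_series]). *)

Set Implicit Arguments.
Unset Strict Implicit.
Unset Printing Implicit Defensive.

Import GroupScope.

(** T acts on its right cosets in G and fixes the coset T itself. Any other
    orbit has fewer than |G : T| elements, and its size divides the order of G,
    whose prime divisors are at least |G : T|; so its size is 1. Thus T fixes all
    its cosets, and fixed cosets are those of 'N_G(T). *)
Lemma normal_index_min_prime (gT : finGroupType) (G T : {group gT}) :
    T \subset G ->
    (forall q, prime q -> q %| #|G| -> #|G : T| <= q) ->
  T <| G.
Proof.
move=> sTG min_q; rewrite /normal sTG /=.
suff fixT : rcosets T G \subset 'Fix_('Rs)(T).
  apply/subsetP=> x Gx.
  have: T :* x \in 'Fix_(rcosets T G | 'Rs)(T).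
    rewrite inE (subsetP fixT) ?andbT; rewrite mem_rcosets mulSGid //.
  rewrite afixRs_rcosets mem_rcosets mulSGid; first by case/setIP.
  by rewrite subsetI sTG normG.
apply/subsetP=> X GX.
have [-> | ntX] := eqVneq X T.
  by apply/afixP=> t Tt; rewrite /= rcosetE rcoset_id.
have T1 : gval T \in rcosets T G.
  by apply/rcosetsP; exists 1; rewrite ?mulg1.
have fixT1 : {in T, forall t, 'Rs%act (gval T) t = T}.
  by move=> t Tt; rewrite /= rcosetE rcoset_id.
have sOG : orbit 'Rs T X \subset rcosets T G :\ gval T.
  rewrite subsetD1; apply/andP; split.
    rewrite acts_sub_orbit //.
    exact: subset_trans sTG (actsRs_rcosets T G).
  apply/negP=> /orbitP[t Tt XtT]; case/eqP: ntX.
  by rewrite -(actK 'Rs t X) XtT fixT1 ?groupV.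
have ltO : #|orbit 'Rs T X| < #|G : T|.
  rewrite (leq_ltn_trans (subset_leq_card sOG)) //.
  by rewrite [#|G : T|](cardsD1 (gval T)) T1.
suff: #|orbit 'Rs T X| = 1%N.
  move=> O1; apply/afixP=> t Tt; apply/set1P.
  by rewrite -(card_orbit1 O1) mem_orbit.
apply/eqP; apply: contraTT ltO => ntO; rewrite -leqNgt.
have O_gt1 : 1 < #|orbit 'Rs T X|.
  rewrite ltn_neqAle eq_sym ntO card_gt0; apply/set0Pn; exists X.
  exact: orbit_refl.
apply: leq_trans (dvdn_leq (ltnW O_gt1) (pdiv_dvd _)).
apply: min_q; first exact: pdiv_prime.
apply: dvdn_trans (pdiv_dvd _) (dvdn_trans (dvdn_orbit _ _ _) (cardSg sTG)).
Qed.

(** Q acts on H through a subgroup of Aut H, of order dividing |H| - 1, whereas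
    the prime divisors of |Q| are at least |H|. *)
Lemma cent_min_prime (gT : finGroupType) (H Q : {group gT}) :
    prime #|H| -> Q \subset 'N(H) ->
    (forall q, prime q -> q %| #|Q| -> #|H| <= q) ->
  Q \subset 'C(H).
Proof.
move=> pr_H nHQ min_q.
rewrite -ker_conj_aut -sub_morphim_pre //.
have [//|ntA] := eqVneq (conj_aut H @* Q) 1.
  by move->.
have/pdivP[q q_pr q_dvd] : 1 < #|conj_aut H @* Q| by rewrite cardG_gt1.
have: q <= #|H|.-1.
  apply: dvdn_leq; first by rewrite -subn1 subn_gt0 prime_gt1.
  rewrite -totient_prime // -card_Aut_cyclic ?prime_cyclic //.
  exact: dvdn_trans q_dvd (cardSg (Aut_conj_aut H Q)).
have := min_q q q_pr (dvdn_trans q_dvd (dvdn_morphim _ _)).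
move=> leHq leqH; have:= leq_trans leHq leqH.
by rewrite leqNgt prednK ?leqnn ?prime_gt0.
Qed.

(** The Frattini subgroup of H is trivial, and a nontrivial S-permutable subgroup
    of H can only be H itself. *)
Lemma weakly_SPhi_prime (gT : finGroupType) (G H : {group gT}) :
    prime #|H| -> weakly_SPhi_supplemented G H ->
  s_permutable G H \/
  exists T : {group gT}, [/\ T \subset G, G = H * T :> {set gT} & H :&: T = 1].
Proof.
move=> pr_H [T [sTG defG]].
have -> : 'Phi(H) = 1.
  by apply/eqP; rewrite (trivg_Phi (pnat_id pr_H)) prime_abelem.
rewrite mul1g => sHTs.
case: (boolP (s_permutable G H)) => [|npermH]; [by left | right].
exists T; split=> //; apply/trivgP/(subset_trans sHTs).
rewrite gen_subG; apply/bigcupsP=> A /andP[sAH permA].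
have [sHA | tiHA] := prime_subgroupVti A pr_H.
  case/negP: npermH; have <- // : A = H.
  by apply/eqP; rewrite -val_eqE eqEsubset sAH.
by rewrite -(setIidPl sAH) tiHA.
Qed.

(** For each Sylow p-subgroup R, permutability makes H R a p-group containing R,
    so H lies in R; hence H lies in the intersection of the conjugates of R. *)
Lemma s_permutable_pcore (gT : finGroupType) (G H : {group gT}) (p : nat) :
  p.-group H -> s_permutable G H -> H \subset 'O_p(G).
Proof.
move=> pH /andP[sHG /forallP permH].
have [S sylS] := Sylow_exists p G.
have sHJ x : x \in G -> H \subset S :^ x.
  move=> Gx; have sylSx : p.-Sylow(G) (S :^ x)%G by rewrite pHallJ.
  have:= permH (S :^ x)%G; rewrite (p_Sylow sylSx) => /= /eqP cHS.
  have pHS : p.-group (H <*> (S :^ x)%G).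
    by rewrite /= comm_joingE // pgroupM pH pgroupJ (pHall_pgroup sylS).
  have sHSG : H <*> (S :^ x)%G \subset G.
    by rewrite join_subG sHG (pHall_sub sylSx).
  by rewrite -(sub_pHall sylSx pHS) ?joing_subr ?joing_subl.
apply: subset_trans (_ : gcore S G \subset _); first exact/bigcapsP.
apply: pcore_max; first exact: pgroupS (gcore_sub _ _) (pHall_pgroup sylS).
by rewrite gcore_normal // (pHall_sub sylS).
Qed.

(** Since H lies in O_p(G), which meets Q trivially, Dedekind's law gives
    H = O_p(G) :&: H Q. Hence Q normalises H, and the order of H leaves it no
    room for a nontrivial action. *)
Lemma s_permutable_cent_Sylow (gT : finGroupType) (G H Q : {group gT}) :
    prime #|H| -> (forall q, prime q -> q %| #|G| -> #|H| <= q) ->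
    s_permutable G H -> Sylow G Q -> #|H|^'.-group Q ->
  Q \subset 'C(H).
Proof.
move=> pr_H min_q permH sylQ p'Q; have sQG := pHall_sub (Hall_pi (andP sylQ).2).
have /eqP cHQ := implyP (forallP (andP permH).2 Q) sylQ.
have sHO : H \subset 'O_(#|H|)(G).
  by apply: s_permutable_pcore => //; rewrite /pgroup pnat_id.
apply: cent_min_prime => // [|q q_pr qQ]; last first.
  exact: min_q q_pr (dvdn_trans qQ (cardSg sQG)).
have tiQO : Q :&: 'O_(#|H|)(G) = 1.
  by rewrite setIC coprime_TIg // (pnat_coprime (pcore_pgroup _ _)).
have defH : H = 'O_(#|H|)(G) :&: (H * Q) :> {set gT}.
  by rewrite setIC -group_modl // tiQO mulg1.
have nHQQ : Q \subset 'N(H * Q).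
  by rewrite -comm_joingE // (subset_trans _ (normG _)) ?joing_subr.
rewrite [X in _ \subset 'N(X)]defH normsI //.
exact: subset_trans sQG (gFnorm _ _).
Qed.

(** The subgroup O^p(G), the least normal subgroup of p-power index. It is
    generated here by Sylow subgroups rather than by all p'-elements because
    S-permutability speaks of Sylow subgroups only. *)
Definition p_residual (p : nat) (gT : finGroupType) (G : {group gT}) :=
  <<\bigcup_(Q : {group gT} | Sylow G Q && p^'.-group Q) Q>>%G.

Lemma p_residual_normal (p : nat) (gT : finGroupType) (G : {group gT}) :
  p_residual p G <| G.
Proof.
apply/andP; split.
  rewrite gen_subG; apply/bigcupsP=> Q /andP[/andP[_ hallQ] _].
  exact: pHall_sub (Hall_pi hallQ).
apply/norms_gen/subsetP=> x Gx; rewrite inE; apply/subsetP=> _ /imsetP[y + ->].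
case/bigcupP=> Q /andP[/SylowP[q q_pr sylQ] p'Q] Qy.
apply/bigcupP; exists (Q :^ x)%G; last by rewrite memJ_conjg.
have sylQx : q.-Sylow(G) (Q :^ x)%G by rewrite pHallJ.
by rewrite (p_Sylow sylQx) pgroupJ.
Qed.

Lemma sub_p_residual (p : nat) (gT : finGroupType) (G Q : {group gT}) :
  Sylow G Q -> p^'.-group Q -> Q \subset p_residual p G.
Proof. by move=> sylQ p'Q; apply/sub_gen/bigcup_sup; rewrite sylQ. Qed.

(** A prime q <> p cannot divide the index, since the residual contains a full
    Sylow q-subgroup. *)
Lemma p_residual_index (p : nat) (gT : finGroupType) (G : {group gT}) :
  p.-nat #|G : p_residual p G|.
Proof.
have sKG := normal_sub (p_residual_normal p G).
apply/pnatP=> // q q_pr q_dvd; apply: contraLR q_dvd => /= p'q.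
have [Q sylQ] := Sylow_exists q G.
have p'Q : p^'.-group Q.
  by apply: sub_in_pnat (pHall_pgroup sylQ) => r _ /eqnP ->.
have sQK := sub_p_residual (p_Sylow sylQ) p'Q.
have: q^'.-nat #|G : Q| by case/and3P: sylQ.
rewrite -(Lagrange_index sKG sQK) pnatM => /andP[+ _].
by rewrite p'natE.
Qed.

Lemma p_residual_sub_normal (p : nat) (gT : finGroupType) (G T : {group gT}) :
  T <| G -> p.-nat #|G : T| -> p_residual p G \subset T.
Proof.
case/andP=> sTG nTG pGT; rewrite gen_subG; apply/bigcupsP=> Q /andP[sylQ p'Q].
have sQG : Q \subset G by case/SylowP: sylQ => q _ /pHall_sub.
rewrite -quotient_sub1 ?(subset_trans sQG) //; apply/trivgP/card1_trivg.
apply: (@pnat_1 p); last exact: quotient_pgroup.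
by apply: pgroupS (quotientS T sQG) _; rewrite /pgroup card_quotient.
Qed.

(** If g = d s with d in D and s in S, and x and x ^ g are in S, then so is
    x ^ d, and [~ x, d] lies in D :&: S = 1. So x ^ g = x ^ s. *)
Lemma strongly_closed_normal_compl (p : nat) (gT : finGroupType)
    (G S D A : {group gT}) (sylS : p.-Sylow(G) S) :
    D <| G -> D * S = G -> D :&: S = 1 -> A <| S ->
  strongly_closed (fusion_of_group sylS) A.
Proof.
move=> /andP[_ nDG] defG tiDS /andP[sAS nAS]; split=> // P phi sPA.
case=> _ _ [g [Gg sPgS def_phi]].
have:= Gg; rewrite -defG => /mulsgP[d s Dd Ss def_g].
apply/subsetP=> _ /imsetP[x Px ->]; rewrite def_phi //.
have Sx : x \in S by rewrite (subsetP sAS) // (subsetP sPA).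
have Sxd : x ^ d \in S.
  rewrite -(groupJr _ (groupVr Ss)) groupJ ?groupV //.
  rewrite -(memJ_conjg _ s) conjGid // -conjgM -def_g.
  by rewrite (subsetP sPgS) ?memJ_conjg.
have cxd : [~ x, d] = 1.
  apply/set1P; rewrite -set1gE -tiDS inE; apply/andP; split.
    rewrite commgEr groupM // memJ_norm ?groupV // (subsetP nDG) //.
    by rewrite (subsetP (pHall_sub sylS)).
  by rewrite commgEl groupM ?groupV.
have <- : x ^ s = x ^ g.
  by rewrite def_g conjgM [x ^ d]conjg_mulR cxd mulg1.
by rewrite memJ_norm ?(subsetP nAS) // (subsetP sPA).
Qed.

(** A nontrivial normal subgroup of a p-group S contains a subgroup of index p
    that is normal in S: this is the next term downwards. *)
Lemma pgroup_normal_series (p : nat) (gT : finGroupType) (S A : {group gT}) :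
    p.-group S -> A <| S ->
  exists (n : nat) (U : nat -> {group gT}),
    [/\ U 0%N = 1 :> {set gT}, U n = A,
        forall i, i < n -> U i \subset U i.+1,
        forall i, i <= n -> U i <| S
      & forall i, i < n -> cyclic (U i.+1 / U i)].
Proof.
move=> pS.
have [k] := ubnP #|A|; elim: k A => // k IHk A; rewrite ltnS => leAk nAS.
have pA := pgroupS (normal_sub nAS) pS.
have [A1 | ntA] := eqsVneq A 1.
  exists 0, (fun _ => A); split=> // i; rewrite leqn0 => /eqP _ //.
have [p_pr _ [e oA]] := pgroup_pdiv pA ntA.
have [|B [sBA nBS oB]] := @normal_pgroup p gT e S A pS nAS.
  by rewrite oA pfactorK.
have indexB : #|A : B| = p.
  by rewrite -divgS // oA oB expnS mulnK // expn_gt0 prime_gt0.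
have ltBA : #|B| < #|A|.
  by rewrite oA oB ltn_exp2l ?prime_gt1.
have [n [U [U0 Un sU nU cU]]] := IHk B (leq_trans ltBA leAk) nBS.
exists n.+1, (fun i => if i <= n then U i else A); split.
- exact: U0.
- by rewrite ltnn.
- move=> i; rewrite ltnS => le_in; rewrite le_in.
  case: ltngtP le_in => // [lt_in | ->] _; first exact: sU.
  by rewrite Un.
- by move=> i _; case: ifP => [/nU|].
move=> i; rewrite ltnS => le_in; rewrite le_in.
case: ltngtP le_in => // [lt_in | ->] _; first exact: cU.
rewrite Un prime_cyclic // card_quotient ?indexB //.
exact: subset_trans (normal_sub nAS) (normal_norm nBS).
Qed.

Theorem theorem1p10 (gT : finGroupType) (G S : {group gT}) (p : nat)
    (p_pr : prime p) (p_dvd : p %| #|G|)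
    (p_min : forall q : nat, prime q -> q %| #|G| -> p <= q)
    (sylS : p.-Sylow(G) S)
    (expS : exponent S = p)
    (minS : forall H : {group gT},
       H \subset S -> prime #|H| -> weakly_SPhi_supplemented G H) :
  supersolvable (fusion_of_group sylS).
Proof.
have [sSG pS _] := and3P sylS.
set K := p_residual p G; have nKG : K <| G := p_residual_normal p G.
pose P := (K :&: S)%G.
have sylP : p.-Sylow(K) P := Sylow_setI_normal nKG sylS.
have cPK : P \subset 'C(K).
  apply/subsetP=> x /setIP[Kx Sx].
  have [-> // | ntx] := eqVneq x 1.
  have ox : #[x] = p.
    by apply: nt_prime_order => //; rewrite -expS expg_exponent.
  have oH : #|<[x]>| = p := ox.
  have pr_H : prime #|<[x]>| by rewrite oH.
  rewrite -cycle_subG centsC.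
  have sHS : <[x]> \subset S by rewrite cycle_subG.
  have := weakly_SPhi_prime pr_H (minS _ sHS pr_H).
  case=> [permH | [T [sTG defG tiHT]]].
    rewrite gen_subG; apply/bigcupsP=> Q /andP[sylQ p'Q].
    by apply: s_permutable_cent_Sylow permH sylQ _; rewrite ?oH.
  have indexT : #|G : T| = p.
    by rewrite -divgS // defG (TI_cardMg tiHT) mulnK // oH.
  have nTG : T <| G by apply: normal_index_min_prime; rewrite ?indexT.
  have sKT : K \subset T.
    by apply: p_residual_sub_normal; rewrite ?indexT ?pnat_id.
  (* x lies both in its own cyclic subgroup and in the complement T. *)
  case/eqP: ntx; apply/set1P; rewrite -set1gE -tiHT inE cycle_id.
  exact: subsetP Kx.
have nPK : P <| K.
  by rewrite /normal (pHall_sub sylP) cents_norm // centsC.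
have /splitsP[D complD] := SchurZassenhaus_split (pHall_Hall sylP) nPK.
(* As P is central, its complement D is normal in K, so D = O_{p'}(K). *)
have hallD : p^'.-Hall(K) D by rewrite -(compl_pHall D sylP).
have [tiPD defK] := complP complD.
have nDK : D <| K.
  rewrite /normal (pHall_sub hallD) -defK mulG_subG normG andbT.
  by rewrite cents_norm // (subset_trans cPK) // centS // (pHall_sub hallD).
have nDG : D <| G.
  by rewrite -(normal_Hall_pcore hallD nDK)
    (char_normal_trans (pcore_char _ _)).
have defG : D * S = G.
  have <- : K * S = G.
    apply: coprime_index_mulG; rewrite ?(normal_sub nKG) //.
    apply: pnat_coprime (p_residual_index p G) _.
    by case/and3P: sylS.
  have nDP : P \subset 'N(D).
    exact: subset_trans (subset_trans (subsetIr K S) sSG) (normal_norm nDG).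
  by rewrite -defK (normC nDP) -mulgA (mulSGid (subsetIr K S)).
have tiDS : D :&: S = 1.
  by rewrite setIC coprime_TIg // (pnat_coprime pS (pHall_pgroup hallD)).
have [n [U [U0 Un sU nU cU]]] := pgroup_normal_series pS (normal_refl S).
exists n, U; split=> // i le_in.
exact: strongly_closed_normal_compl nDG defG tiDS (nU i le_in).
Qed.
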